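(* Let $F$ be an algebraically closed field. Let $\tau=\prod_{p \text{ prime}}p^{k_p}$ be a Steinitz number such that $k_q=\infty$ for some prime $q$. Then for every infinite cardinal $\alpha$ there exists a unital locally matrix algebra $A$ over $F$ with $\dim_F A=\alpha$ and $\mathbf{n}(A)=\tau$.
   Context: A Steinitz number is a formal product $\prod_p p^{k_p}$ over primes with $k_p\in\mathbb{N}\cup\{0,\infty\}$, ordered by divisibility (exponents add with $t+\infty=\infty$). A unital algebra $A$ is locally matrix if every finite subset lies in a subalgebra $B$ with $1_A\in B$ and $B\cong M_n(F)$ for some $n$. $D(A)$ is the set of $n$ for which $A$ has a subalgebra containing $1_A$ isomorphic to $M_n(F)$, and $\mathbf{n}(A)$ is the least common multiple of $D(A)$. *)

(* Defs.v *)
From HB Require Import structures.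
From mathcomp Require Import all_boot all_algebra.
Set Implicit Arguments. Unset Strict Implicit. Unset Printing Implicit Defensive.
Import GRing.Theory.
Local Open Scope ring_scope.

(* Extended naturals N ∪ {∞}: [Some k] is k, [None] is ∞. *)
Definition enat := option nat.
Definition enat_le (a b : enat) : Prop :=
  match a, b with
  | _, None => True
  | None, Some _ => False
  | Some m, Some n => (m <= n)%N
  end.

(* A Steinitz number prod_p p^{k_p}: the exponent function p |-> k_p.
   Only the values at primes p are meaningful. *)
Definition steinitz := nat -> enat.

Definition steinitz_dvd (a b : steinitz) : Prop :=
  forall p, prime p -> enat_le (a p) (b p).

Definition steinitz_of_nat (n : nat) : steinitz := fun p => Some (logn p n).

Definition is_steinitz_lcm (D : nat -> Prop) (tau : steinitz) : Prop :=
  (forall n, D n -> steinitz_dvd (steinitz_of_nat n) tau) /\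
  (forall sigma : steinitz,
      (forall n, D n -> steinitz_dvd (steinitz_of_nat n) sigma) ->
      steinitz_dvd tau sigma).

(* f : M_n(F) -> A is an injective unital F-algebra homomorphism; its image is
   a subalgebra of A containing 1_A and isomorphic to M_n(F). *)
Definition unital_alg_embedding (F : fieldType) (A : algType F) (n : nat)
  (f : 'M[F]_n.+1 -> A) : Prop :=
  [/\ forall (a : F) (x y : 'M[F]_n.+1), f (a *: x + y) = a *: f x + f y,
      forall x y : 'M[F]_n.+1, f (x * y) = f x * f y,
      f 1 = 1 & injective f].

Definition Dset (F : fieldType) (A : algType F) (n : nat) : Prop :=
  (0 < n)%N /\ exists f : 'M[F]_n.-1.+1 -> A, unital_alg_embedding f.

Definition locally_matrix (F : fieldType) (A : algType F) : Prop :=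
  forall s : seq A, exists (n : nat) (f : 'M[F]_n.+1 -> A),
    unital_alg_embedding f /\ forall x, x \in s -> exists y, f y = x.

Definition steinitz_n_eq (F : fieldType) (A : algType F) (tau : steinitz) :=
  is_steinitz_lcm (Dset A) tau.

Definition infinite_type (T : Type) : Prop :=
  ~ exists (n : nat) (f : T -> 'I_n), injective f.

Definition in_range (A T : Type) (b : T -> A) (x : A) : Prop := exists t, b t = x.

Definition is_basis_family (F : fieldType) (A : algType F) (T : Type)
  (b : T -> A) : Prop :=
  [/\ injective b,
      (forall (s : seq A) (c : seq F),
          uniq s -> (forall x, x \in s -> in_range b x) -> size c = size s ->
          \sum_(i < size s) c`_i *: s`_i = 0 ->
          forall i, (i < size s)%N -> c`_i = 0)
    & (forall x : A, exists (s : seq A) (c : seq F),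
          (forall y, y \in s -> in_range b y) /\
          x = (\sum_(i < size s) c`_i *: s`_i))].

Definition dim_eq_card (F : fieldType) (A : algType F) (T : Type) : Prop :=
  exists b : T -> A, is_basis_family b.

(* Main.v *)
Require Import Defs.
From HB Require Import structures.
From mathcomp Require Import all_boot all_algebra.
From mathcomp Require Import boolp classical_sets functions cardinality.
Set Implicit Arguments. Unset Strict Implicit. Unset Printing Implicit Defensive.
Import GRing.Theory.
Local Open Scope ring_scope.

(* Let I be the disjoint union of T and of nat * nat.  To every i in I attach a
   size n_i: q for i in T, and p for i = (p, j) with p prime and j < k_p (1 for the
   other pairs).  In the endomorphism algebra of the space of functions on the
   product of the sets {0, ..., n_i - 1}, the operators that act on the single
   coordinate i contain a system of n_i x n_i matrix units; systems with different
   indices commute, and A is the algebra that they all generate, i.e. the infinite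
   tensor product of the M_{n_i}(F).
   A finite subset of A involves finitely many coordinates, hence lies in a copy of
   M_N(F) with N a finite product of the n_i; an embedding of M_n(F) into A thus
   gives one into some M_N(F), and n divides N by comparing ranks of idempotents.
   The words in the matrix units span A and form a set of cardinality |T|, since
   |T x T| = |T|; the idempotents e_t(0, 0), t in T, are linearly independent.  A
   maximal independent set of words containing these idempotents is a basis of
   cardinality |T| by the Cantor-Bernstein theorem. *)

(** * Comparison of cardinalities by injections *)

Definition embeds (A B : Type) := exists f : A -> B, injective f.

Lemma embeds_trans B A C : embeds A B -> embeds B C -> embeds A C.
Proof. by case=> f fI [g gI]; exists (g \o f); exact: inj_comp. Qed.

Lemma embeds_prod A B C D : embeds A B -> embeds C D -> embeds (A * C) (B * D).
Proof.
case=> f fI [g gI]; exists (fun x => (f x.1, g x.2)).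
by move=> [a c] [a' c'] [] /fI -> /gI ->.
Qed.

(** The graph of an injection from a subset of [A] into [B]. *)
Definition is_matching (A B : Type) (G : set (A * B)) :=
  forall p p', G p -> G p' -> p.1 = p'.1 <-> p.2 = p'.2.

Lemma bigcup_pair (X : Type) (F : set (set X)) (p p' : X) :
  total_on F subset -> (\bigcup_(Y in F) Y)%classic p ->
  (\bigcup_(Y in F) Y)%classic p' -> exists2 Y, F Y & Y p /\ Y p'.
Proof.
move=> tot [Y FY Yp] [Z FZ Zp']; case: (tot _ _ FY FZ) => sub.
  by exists Z => //; split => //; exact: sub.
by exists Y => //; split => //; exact: sub.
Qed.

(** A maximal matching exhausts [A] or [B], since an unmatched point on each side would give a pair
    to add. It is then the graph of an injection defined on the whole of that side. *)
Lemma embeds_total A B : embeds A B \/ embeds B A.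
Proof.
have [F FP tot|G [Gm Gmax]] := @Zorn_bigcup _ (@is_matching A B).
  move=> p p' Fp Fp'.
  by have [Y FY [Yp Yp']] := bigcup_pair tot Fp Fp'; exact: (FP Y).
have [|/existsNP [a aG]] := pselect (forall a, exists b, G (a, b)).
  move=> /choice [f fG]; left; exists f => a a' /= e.
  by have [_] := Gm _ _ (fG a) (fG a'); apply.
right; have [|/existsNP [b bG]] := pselect (forall b, exists a, G (a, b)).
  move=> /choice [f fG]; exists f => b b' /= e.
  by have [+ _] := Gm _ _ (fG b) (fG b'); apply.
exfalso; apply: (Gmax (G `|` [set (a, b)])%classic).
  split; first by move=> p Gp; left.
  by move=> /(_ (a, b)) H; apply: aG; exists b; apply: H; right.
move=> p p' [Gp|->] [Gp'|->] //=; first exact: Gm.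
- split=> e; [case: aG; exists p.2 | case: bG; exists p.1].
    by rewrite -e -surjective_pairing.
  by rewrite -e -surjective_pairing.
- split=> e; [case: aG; exists p'.2 | case: bG; exists p'.1].
    by rewrite e -surjective_pairing.
  by rewrite e -surjective_pairing.
Qed.

Lemma infinite_type_nat T : infinite_type T -> embeds nat T.
Proof.
move=> hT; have /choice [new newP] (s : seq {classic T}) : exists x, x \notin s.
  apply: contrapT => /forallNP sT; apply: hT.
  (* If the list [s] exhausted [T], positions in [s] would embed [T] into a finite ordinal. *)
  have ltT (x : T) : (index (x : {classic T}) s < size s)%N.
    by rewrite index_mem; apply/negPn/negP; exact: sT.
  exists (size s), (fun x => Ordinal (ltT x)) => x y [] e.
  have sI z : nth (x : {classic T}) s (index (z : {classic T}) s) = z.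
    by apply: nth_index; rewrite -index_mem; exact: ltT.
  by rewrite -[x]sI e sI.
(* [first n] lists the first [n] choices, so that each new choice avoids all the earlier ones. *)
pose first := fix first n := if n is m.+1 then new (first m) :: first m else [::].
have firstP m n : (m < n)%N -> new (first m) \in first n.
  elim: n => // n IH; rewrite ltnS leq_eqVlt inE => /predU1P[->|/IH ->].
    by rewrite eqxx.
  by rewrite orbT.
exists (fun n => new (first n)) => m n e.
by case: (ltngtP m n) => // /firstP; rewrite ?e ?(negPf (newP _)) // -e (negPf (newP _)).
Qed.

(* Zorn on injections [D * D -> D], given by their graphs, with [D] read off the diagonal. *)
Section square.
Variable T : Type.
Implicit Type G : set (T * T * T).

Definition square_dom G x := exists z, G (x, x, z).

Definition square_graph G :=
  [/\ is_matching G,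
      (forall x y z, G (x, y, z) -> [/\ square_dom G x, square_dom G y & square_dom G z])
    & (forall x y, square_dom G x -> square_dom G y -> exists z, G (x, y, z))].

Lemma square_graph_bigcup (F : set (set (T * T * T))) :
  (forall G, F G -> square_graph G) -> total_on F subset ->
  square_graph (\bigcup_(G in F) G)%classic.
Proof.
move=> FP tot.
have up G x : F G -> square_dom G x -> square_dom (\bigcup_(G in F) G)%classic x.
  by move=> FG [z Gz]; exists z; exists G.
split.
- move=> p p' Fp Fp'; have [Y FY [Yp Yp']] := bigcup_pair tot Fp Fp'.
  by have [+ _ _] := FP _ FY; exact.
- move=> x y z [G FG Gp]; have [_ + _] := FP _ FG => /(_ _ _ _ Gp) [Dx Dy Dz].
  by split; exact: up FG _.
- move=> x y [z1 Fx] [z2 Fy]; have [G FG [Gx Gy]] := bigcup_pair tot Fx Fy.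
  have [_ _ /(_ x y)] := FP _ FG.
  by case=> [||z Gz]; [exists z1|exists z2|exists z; exists G].
Qed.

Section extend.
Variables (G : set (T * T * T)) (sG : square_graph G).
Let D := {x | square_dom G x}.
Variables (f : D * D -> D) (fG : forall p, G (sval p.1, sval p.2, sval (f p))).
Variables (h : D -> T) (hI : injective h) (hN : forall d, ~ square_dom G (h d)).
Variables (k : bool -> D) (kI : injective k).

(** The domain [D] is enlarged by the disjoint copy [h D]. A pair with a new coordinate gets its
    value in [h D], away from all old values; [k] records which coordinates are new, and [f] packs
    this record with the two underlying points of [D]. *)
Let pos (i : bool) (a : D) : T := if i then h a else sval a.
Let code i j a b := h (f (f (k i, k j), f (a, b))).

Let sval_inj : injective (sval : D -> T).
Proof. by move=> [x px] [y py] /= e; apply: eq_exist. Qed.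

Let fI : injective f.
Proof.
move=> [a b] [a' b'] e; case: sG => + _ _ => /(_ _ _ (fG (a, b)) (fG (a', b'))) /=.
by rewrite e => -[_ /(_ erefl)] [/sval_inj -> /sval_inj ->].
Qed.

Let posI i a j b : pos i a = pos j b -> i = j /\ a = b.
Proof.
case: i; case: j => /=.
- by move/hI.
- by move=> e; case: (hN (d := a)); rewrite e; exact: (svalP b).
- by move=> e; case: (hN (d := b)); rewrite -e; exact: (svalP a).
- by move/sval_inj.
Qed.

Let G' := (G `|` [set p | exists i j a b, i || j /\
   p = (pos i a, pos j b, code i j a b)])%classic.

Let dom_pos i a : square_dom G' (pos i a).
Proof.
case: i; first by exists (code true true a a); right; exists true, true, a, a.
by case: (svalP a) => z Gz; exists z; left.
Qed.

Let pos_dom x : square_dom G' x -> exists i a, x = pos i a.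
Proof.
move=> [z [Gz|]]; last first.
  by move=> [i [j [a [b [_ [-> _ _]]]]]]; exists i, a.
have Dx : square_dom G x by exists z.
by exists false, (exist _ x Dx).
Qed.

Lemma square_graph_extend : exists G1, (G `<` G1)%classic /\ square_graph G1.
Proof.
exists G'; have [Gm Gd Gt] := sG; split; last split.
- split; first by move=> p; left.
  move=> /(_ (pos true (k true), pos true (k true), code true true (k true) (k true))) H.
  apply: (hN (d := k true)); eexists; apply: H; right.
  by exists true, true, (k true), (k true).
- have aux p i j a b : G p -> i || j ->
     p.1 <> (pos i a, pos j b) /\ p.2 <> code i j a b.
    case: p => [[x y] z] Gp ij; have [Dx Dy Dz] := Gd _ _ _ Gp; split=> /= e.
      case: e => ex ey; case: i j ij ex ey => [] [] //= _ ex ey.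
      + by apply: (hN (d := a)); rewrite -ex.
      + by apply: (hN (d := a)); rewrite -ex.
      + by apply: (hN (d := b)); rewrite -ey.
    by case: (hN (d := f (f (k i, k j), f (a, b)))); rewrite -[h _]e.
  move=> p p' [Gp|[i [j [a [b [ij ->]]]]]] [Gp'|[i' [j' [a' [b' [ij' ->]]]]]] /=.
  + exact: Gm.
  + by have [n1 n2] := aux _ _ _ a' b' Gp ij'.
  + by have [n1 n2] := aux _ _ _ a b Gp' ij; split=> e; [case: n1|case: n2].
  + split; first by case=> /posI [-> ->] /posI [-> ->].
    by move/hI/fI => [] /fI [/kI -> /kI ->] /fI [-> ->].
- move=> x y z [Gp|[i [j [a [b [_ [-> -> ->]]]]]]].
    have [[u Gu] [v Gv] [w Gw]] := Gd _ _ _ Gp.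
    by split; [exists u; left|exists v; left|exists w; left].
  by split; [exact: dom_pos|exact: dom_pos|exact: (dom_pos true)].
- move=> _ _ /pos_dom [i [a ->]] /pos_dom [j [b ->]].
  have [ij|] := boolP (i || j).
    by exists (code i j a b); right; exists i, j, a, b.
  rewrite negb_or => /andP [/negbTE -> /negbTE ->].
  have [z Gz] := Gt _ _ (svalP a) (svalP b).
  by exists z; left.
Qed.

End extend.

(** Take [D] maximal with an injection of [D * D] into [D]. If [D] embeds into its complement, the
    extension above contradicts maximality. Otherwise the complement embeds into [D], so [T] embeds
    into two copies of [D], hence into [D * D] and into [D]; then [T * T] embeds into [D * D], hence
    into [D] and [T]. *)
Lemma embeds_square : embeds nat T -> embeds (T * T) T.
Proof.
case=> c cI.
pose N := [set p : T * T * T | exists a b, p = (c a, c b, c (pickle (a, b)))]%classic.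
have domN x : square_dom N x <-> exists a, x = c a.
  split=> [[z [a [b [-> _ _]]]]|[a ->]]; first by exists a.
  by exists (c (pickle (a, a))), a, a.
have sN : square_graph N.
  split.
  - move=> _ _ [a [b ->]] [a' [b' ->]] /=; split.
      by case=> /cI -> /cI ->.
    by move/cI/(pcan_inj pickleK) => [-> ->].
  - move=> x y z [a [b [-> -> ->]]].
    by split; apply/domN; eexists.
  - by move=> x y /domN [a ->] /domN [b ->]; eexists; exists a, b.
(* The union with [N] forces the maximal domain to contain the range of [c], hence the two distinct
   points needed for [k], while the empty chain remains admissible. *)
pose P G := square_graph (N `|` G)%classic.
have [F FP tot|G [sG Gmax]] := @Zorn_bigcup _ P.
  have [->|/set0P [G0 FG0]] := eqVneq F set0.
    by rewrite /P bigcup_set0 setU0.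
  rewrite /P.
  have -> : (N `|` \bigcup_(X in F) X = \bigcup_(X in [set N `|` G | G in F]) X)%classic.
    apply/seteqP; split=> p.
      move=> [Np|[G FG Gp]]; first by exists (N `|` G0)%classic; [exists G0|left].
      by exists (N `|` G)%classic; [exists G|right].
    by move=> [_ [G FG <-]] [Np|Gp]; [left|right; exists G].
  apply: square_graph_bigcup; first by move=> _ [G FG <-]; exact: FP.
  move=> _ _ [G FG <-] [G' FG' <-].
  by case: (tot _ _ FG FG') => sub; [left|right]; apply: setUS.
set H := (N `|` G)%classic in sG.
pose D := {x | square_dom H x}.
have [Hm Hd Ht] := sG.
have /choice [f fH] (p : D * D) : exists d : D, H (sval p.1, sval p.2, sval d).
  have [z Hz] := Ht _ _ (svalP p.1) (svalP p.2).
  by have [_ _ Dz] := Hd _ _ _ Hz; exists (exist _ z Dz).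
have sval_inj : injective (sval : D -> T).
  by move=> [x px] [y py] /= e; apply: eq_exist.
have fI : injective f.
  move=> [a b] [a' b'] e; have := Hm _ _ (fH (a, b)) (fH (a', b')).
  by rewrite /= e => -[_ /(_ erefl)] [/sval_inj -> /sval_inj ->].
have cD n : square_dom H (c n).
  by exists (c (pickle (n, n))); left; exists n, n.
pose k (i : bool) : D := exist _ (c i) (cD i).
have kI : injective k by move=> i j [] /cI; case: i; case: j.
have DT : embeds D T by exists sval.
have DDD : embeds (D * D) D by exists f.
case: (embeds_total D {x | ~ square_dom H x}) => [[h hI]|[h hI]].
  exfalso.
  have h'I : injective (fun d => sval (h d)).
    by move=> a b e; apply: hI; case: (h a) (h b) e => [x px] [y py] /= e; apply: eq_exist.
  have [G1 [[HG1 G1H] sG1]] := square_graph_extend sG fH h'I (fun d => svalP (h d)) kI.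
  apply: (Gmax G1); last first.
    rewrite /P; suff -> : (N `|` G1)%classic = G1 by [].
    by apply/setUidPr => p Np; apply: HG1; left.
  split; first by move=> p Gp; apply: HG1; right.
  by move=> G1G; apply: G1H => p /G1G Gp; right.
suff TD : embeds T D.
  by apply: embeds_trans DT; apply: embeds_trans DDD; exact: embeds_prod.
apply: embeds_trans DDD.
pose g (x : T) := match pselect (square_dom H x) with
  | left p => (k true, exist _ x p : D) | right n => (k false, h (exist _ x n)) end.
exists g => x y; rewrite /g; case: pselect => px; case: pselect => py //.
- by case.
- by case=> /cI.
- by case=> /cI.
- by case=> /hI [].
Qed.

End square.

(** Folding the pairing function separates lists of equal length; the length is therefore coded as
    well. *)
Lemma embeds_seq T : embeds nat T -> embeds (seq T) T.
Proof.
move=> /[dup] [[c cI]] /embeds_square [f fI].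
pose code := foldr (fun x r => f (x, r)) (c 0%N).
exists (fun s => f (c (size s), code s)) => s t /fI [/cI es].
elim: s t es => [|x s IH] [|y t] //= [es] /fI [-> e].
by rewrite (IH t).
Qed.

Lemma embeds_antisym A B : embeds A B -> embeds B A -> exists f : A -> B, bijective f.
Proof.
have le (X Y : Type) : embeds X Y -> ([set: X] #<= [set: Y])%card.
  move=> [f fI]; have [|g] := (@injfunPex _ _ [set: X] [set: Y]).2.
    by exists f => // x y _ _; exact: fI.
  exact: inj_card_le.
move=> /le AB /le BA; have /card_bijP [f [g fK gK]] := Cantor_Bernstein AB BA.
exists (fun a => val (f (SigSub (mem_set (I : [set: A]%classic a))))).
exists (fun b => val (g (SigSub (mem_set (I : [set: B]%classic b))))) => x.
  by set u := SigSub _; rewrite (_ : u = f (SigSub (mem_set (I : [set: A]%classic x)))) ?fK //; exact: val_inj.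
by set u := SigSub _; rewrite (_ : u = g (SigSub (mem_set (I : [set: B]%classic x)))) ?gK //; exact: val_inj.
Qed.

(** * Linear independence, spans and bases *)

Section basis.
Variables (F : fieldType) (A : algType F).
Implicit Type B : set A.

Definition lin_free B := forall (s : seq A) (c : A -> F), uniq s ->
  (forall x, x \in s -> B x) -> \sum_(x <- s) c x *: x = 0 ->
  forall x, x \in s -> c x = 0.

Definition lin_span B (x : A) := exists l : seq (F * A),
  (forall p, p \in l -> B p.2) /\ x = \sum_(p <- l) p.1 *: p.2.

Lemma lin_span_add B x y : lin_span B x -> lin_span B y -> lin_span B (x + y).
Proof.
move=> [l [lB ->]] [l' [lB' ->]]; exists (l ++ l'); rewrite big_cat; split => // p.
by rewrite mem_cat => /orP [/lB|/lB'].
Qed.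

Lemma lin_span_scale B a x : lin_span B x -> lin_span B (a *: x).
Proof.
move=> [l [lB ->]]; exists [seq (a * p.1, p.2) | p <- l]; split.
  by move=> _ /mapP [p /lB pB ->].
by rewrite big_map scaler_sumr; apply: eq_bigr => p _; rewrite scalerA.
Qed.

Lemma lin_span0 B : lin_span B 0.
Proof. by exists [::]; rewrite big_nil. Qed.

Lemma lin_span_incl B x : B x -> lin_span B x.
Proof.
move=> Bx; exists [:: (1, x)]; rewrite big_seq1 scale1r; split => // p.
by rewrite inE => /eqP ->.
Qed.

Lemma lin_span_sum B (I : eqType) (r : seq I) (f : I -> A) :
  (forall i, i \in r -> lin_span B (f i)) -> lin_span B (\sum_(i <- r) f i).
Proof.
elim: r => [|i r IH] fB; first by rewrite big_nil; exact: lin_span0.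
rewrite big_cons; apply: lin_span_add; first by apply: fB; rewrite mem_head.
by apply: IH => j jr; apply: fB; rewrite inE jr orbT.
Qed.

Lemma lin_span_trans B B' x :
  (forall y, B y -> lin_span B' y) -> lin_span B x -> lin_span B' x.
Proof.
move=> BB' [l [lB ->]]; apply: lin_span_sum => p /lB /BB'.
exact: lin_span_scale.
Qed.

Lemma lin_free_add B x :
  lin_free B -> ~ lin_span B x -> lin_free (B `|` [set x])%classic.
Proof.
move=> fB nx s c us sB s0.
have [xs|xs] := boolP (x \in s); last first.
  apply: fB => // y ys; have [//|/= yx] := sB _ ys.
  by rewrite -yx ys in xs.
have remB y : y \in rem x s -> B y.
  rewrite (mem_rem_uniq x us) inE => /andP [yx /sB []] // e.
  by rewrite e eqxx in yx.
have remE := perm_to_rem xs.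
move: s0; rewrite (perm_big _ remE) /= big_cons => s0.
have cx : c x = 0.
  have [//|cx] := eqVneq (c x) 0; case: nx.
  have -> : x = - (c x)^-1 *: \sum_(y <- rem x s) c y *: y.
    have -> : \sum_(y <- rem x s) c y *: y = - (c x *: x).
      by apply/eqP; rewrite -addr_eq0 addrC s0.
    by rewrite scaleNr scalerN opprK scalerA mulVf ?scale1r.
  by apply/lin_span_scale/lin_span_sum => y /remB /lin_span_incl /lin_span_scale.
move: s0; rewrite cx scale0r add0r => s0 y.
rewrite (perm_mem remE) inE => /predU1P [->//|].
exact: (fB _ _ (rem_uniq _ us)).
Qed.

(** A maximal independent set spans [S], because [lin_free_add] would adjoin any element of [S]
    outside its span. *)
Lemma basis_between B0 S : lin_free B0 -> (B0 `<=` S)%classic ->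
  exists B, [/\ (B0 `<=` B)%classic, (B `<=` S)%classic, lin_free B
    & forall x, S x -> lin_span B x].
Proof.
move=> fB0 B0S.
(* Zorn runs over the part added to [B0], so that the union of the empty chain is admissible. *)
pose P B := (B `<=` S)%classic /\ lin_free (B0 `|` B)%classic.
have [C CP tot|B [[BS fB] Bmax]] := @Zorn_bigcup _ P.
  split; first by move=> x [B CB Bx]; exact: (CP _ CB).1.
  move=> s c us sC.
  (* A finite family in the union of a chain already lies in one member; the alternative [B0] covers
     the empty chain. *)
  suff [sB0|[B CB sB]] : (forall x, x \in s -> B0 x) \/
      exists2 B, C B & forall x, x \in s -> (B0 `|` B)%classic x.
  - exact: fB0.
  - exact: (CP _ CB).2.
  elim: s {us} sC => [|x s IH] sC; first by left.
  have [|sB0|[B CB sB]] := IH; first by move=> y ys; apply: sC; rewrite inE ys orbT.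
    have [B0x|[B CB Bx]] := sC x (mem_head _ _).
      by left=> y; rewrite inE => /predU1P [->//|/sB0].
    by right; exists B => // y; rewrite inE => /predU1P [->|/sB0]; [right|left].
  right; have [B0x|[B' CB' B'x]] := sC x (mem_head _ _).
    by exists B => // y; rewrite inE => /predU1P [->|/sB //]; left.
  case: (tot _ _ CB CB') => sub; [exists B' => //|exists B => //] => y;
    rewrite inE => /predU1P [->|/sB].
  - by right.
  - by move=> [|/sub]; [left|right].
  - by right; exact: sub.
  - by [].
exists (B0 `|` B)%classic; split => //.
- by move=> x [/B0S|/BS].
move=> x Sx; apply: contrapT => nx; apply: (Bmax (B `|` [set x])%classic).
  split; first by move=> y; left.
  by move=> /(_ x) H; apply: nx; apply: lin_span_incl; right; apply: H; right.
split; first by move=> y [/BS//|->].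
by rewrite setUA; exact: lin_free_add.
Qed.

Lemma lin_free_seq B (s : seq A) (c : seq F) : lin_free B -> uniq s ->
  (forall x, x \in s -> B x) -> \sum_(i < size s) c`_i *: s`_i = 0 ->
  forall i, (i < size s)%N -> c`_i = 0.
Proof.
move=> fB us sB s0 i lti.
have := fB s (fun x => c`_(index x s)) us sB _ s`_i (mem_nth _ lti).
rewrite index_uniq //; apply; rewrite -[RHS]s0 (big_nth 0) big_mkord.
by apply: eq_bigr => j _; rewrite index_uniq.
Qed.

Lemma lin_span_seq B x : lin_span B x -> exists (s : seq A) (c : seq F),
  (forall y, y \in s -> B y) /\ x = \sum_(i < size s) c`_i *: s`_i.
Proof.
move=> [l [lB ->]]; exists [seq p.2 | p <- l], [seq p.1 | p <- l]; split.
  by move=> _ /mapP [p /lB ? ->].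
rewrite (big_nth (0, 0)) big_mkord size_map; apply: eq_bigr => i _.
by rewrite !(nth_map (0, 0)).
Qed.

(** Take a basis between the two ranges. [T] embeds into it through [L]; it embeds into [W], hence
    into [T], by choosing preimages under [S]. Cantor-Bernstein then reindexes it by [T]. *)
Lemma dim_eq_card_between (T W : Type) (L : T -> A) (S : W -> A) :
  injective L -> lin_free (range L) -> (range L `<=` range S)%classic ->
  (forall x, lin_span (range S) x) -> embeds W T -> dim_eq_card A T.
Proof.
move=> LI fL LS spanS WT; have [B [LB BS fB spanB]] := basis_between fL LS.
have TB : embeds T {x | B x}.
  exists (fun t => exist _ (L t) (LB _ (imageP L (I : setT t)))) => t t' [].
  exact: LI.
have BT : embeds {x | B x} T.
  apply: embeds_trans WT.
  have /choice [w wP] (x : {x | B x}) : exists w, S w = sval x.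
    by case: (BS _ (svalP x)) => w _ <-; exists w.
  exists w => x y e; move: (wP x) (wP y); rewrite e => -> .
  by case: x y {e} => [x px] [y py] /= e; exact: eq_exist.
have [b [g bK gK]] := embeds_antisym TB BT.
have range_b x : in_range (sval \o b) x <-> B x.
  split=> [[t <-]|Bx]; first exact: svalP.
  by exists (g (exist _ x Bx)); rewrite /= gK.
exists (sval \o b); split.
- move=> t t' /= e; apply: (can_inj bK).
  by case: (b t) (b t') e => [x px] [y py] /= e; exact: eq_exist.
- move=> s c us sb _ s0; apply: (lin_free_seq fB us _ s0).
  by move=> x /sb /range_b.
- move=> x; have /lin_span_seq [s [c [sB ->]]] : lin_span B x.
    by apply: lin_span_trans (spanS x).
  by exists s, c; split => // y /sB /range_b.
Qed.

End basis.

(** * Systems of matrix units *)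

Section matrix_units.
Variables (F : fieldType) (A : algType F).

(** An arbitrary finite index type allows products of systems to be indexed by pairs, without
    arithmetic on indices. *)
Definition matrix_units (U : finType) (e : U -> U -> A) :=
  (forall a b c d, e a b * e c d = if b == c then e a d else 0) /\
  \sum_a e a a = 1.

Definition unit_span (U : finType) (e : U -> U -> A) (x : A) :=
  exists M : U -> U -> F, x = \sum_a \sum_b M a b *: e a b.

Lemma unit_span_unit (U : finType) (e : U -> U -> A) a b : unit_span e (e a b).
Proof.
exists (fun a' b' => ((a' == a) && (b' == b))%:R).
rewrite (bigD1 a) //= (bigD1 b) //= !eqxx scale1r !big1 ?addr0 // => [a' /negbTE ->|b' /negbTE ->].
  by rewrite big1 // => b' _; rewrite scale0r.
by rewrite scale0r.
Qed.

Lemma unit_span_add (U : finType) (e : U -> U -> A) x y :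
  unit_span e x -> unit_span e y -> unit_span e (x + y).
Proof.
move=> [M ->] [N ->]; exists (fun a b => M a b + N a b).
rewrite -big_split; apply: eq_bigr => a _; rewrite -big_split.
by apply: eq_bigr => b _; rewrite scalerDl.
Qed.

Lemma unit_span_scale (U : finType) (e : U -> U -> A) k x :
  unit_span e x -> unit_span e (k *: x).
Proof.
move=> [M ->]; exists (fun a b => k * M a b).
rewrite scaler_sumr; apply: eq_bigr => a _; rewrite scaler_sumr.
by apply: eq_bigr => b _; rewrite scalerA.
Qed.

Lemma unit_span0 (U : finType) (e : U -> U -> A) : unit_span e 0.
Proof.
by exists (fun _ _ => 0); rewrite big1 // => a _; rewrite big1 // => b _; rewrite scale0r.
Qed.

Lemma unit_span_sum (U : finType) (e : U -> U -> A) (I : Type) (r : seq I) (P : pred I) (f : I -> A) :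
  (forall i, P i -> unit_span e (f i)) -> unit_span e (\sum_(i <- r | P i) f i).
Proof.
move=> fe; elim/big_ind : _ => //; [exact: unit_span0|exact: unit_span_add].
Qed.

Lemma unit_span1 (U : finType) (e : U -> U -> A) : matrix_units e -> unit_span e 1.
Proof. by case=> _ <-; apply: unit_span_sum => a _; exact: unit_span_unit. Qed.

Lemma unit_span_mul (U : finType) (e : U -> U -> A) x y :
  matrix_units e -> unit_span e x -> unit_span e y -> unit_span e (x * y).
Proof.
move=> [eM _] [M ->] [N ->].
rewrite mulr_suml; apply: unit_span_sum => a _.
rewrite mulr_suml; apply: unit_span_sum => b _.
rewrite mulr_sumr; apply: unit_span_sum => c _.
rewrite mulr_sumr; apply: unit_span_sum => d _.
rewrite -scalerAl -scalerAr eM; do 2 apply: unit_span_scale.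
by case: eqP => _; [exact: unit_span_unit|exact: unit_span0].
Qed.

Lemma matrix_units_embedding n (e : 'I_n.+1 -> 'I_n.+1 -> A) : matrix_units e ->
  unital_alg_embedding (fun M : 'M[F]_n.+1 => \sum_i \sum_j M i j *: e i j).
Proof.
move=> [eM e1].
(* Compression by [e i i] and [e j i] isolates a single coefficient, which will give injectivity. *)
have coord (M : 'M[F]_n.+1) i j :
    e i i * (\sum_i \sum_j M i j *: e i j) * e j i = M i j *: e i i.
  rewrite mulr_sumr (bigD1 i) //= [X in _ + X]big1 ?addr0 => [|i' /negbTE ni]; last first.
    by rewrite mulr_sumr big1 // => k _; rewrite -scalerAr eM eq_sym ni scaler0.
  rewrite mulr_sumr mulr_suml (bigD1 j) //= [X in _ + X]big1 ?addr0 => [|j' /negbTE nj].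
    by rewrite -scalerAr -scalerAl !eM !eqxx eM eqxx.
  by rewrite -scalerAr -scalerAl !eM eqxx eM nj scaler0.
split.
- move=> a x y; rewrite scaler_sumr -big_split; apply: eq_bigr => i _ /=.
  rewrite scaler_sumr -big_split; apply: eq_bigr => j _ /=.
  by rewrite !mxE scalerDl scalerA.
- move=> x y; rewrite mulr_suml; apply: eq_bigr => i _.
  rewrite mulr_suml.
  transitivity (\sum_k \sum_j (x i k * y k j) *: e i j).
    rewrite exchange_big; apply: eq_bigr => j _.
    by rewrite mxE scaler_suml.
  apply: eq_bigr => k _; apply: esym.
  rewrite mulr_sumr (bigD1 k) //= [X in _ + X]big1 ?addr0 => [|k' /negbTE nk].
    rewrite mulr_sumr; apply: eq_bigr => j _.
    by rewrite -scalerAl -scalerAr eM eqxx scalerA.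
  rewrite mulr_sumr big1 // => j _.
  by rewrite -scalerAl -scalerAr eM eq_sym nk !scaler0.
- rewrite -e1; apply: eq_bigr => i _; rewrite (bigD1 i) //= big1 => [|j /negbTE nj].
    by rewrite mxE eqxx scale1r addr0.
  by rewrite mxE eq_sym nj scale0r.
- move=> x y xy; apply/matrixP => i j.
  have : (x i j - y i j) *: e i i = 0.
    by rewrite scalerBl -!coord xy subrr.
  move/eqP; rewrite scaler_eq0 subr_eq0 => /orP [/eqP //|/eqP e0].
  (* If [e i i] vanished, so would 1. *)
  have : \sum_k e k i * e i i * e i k = 1 :> A.
    by rewrite -e1; apply: eq_bigr => k _; rewrite eM eqxx eM eqxx.
  rewrite big1 => [/esym/eqP|k _]; first by rewrite oner_eq0.
  by rewrite e0 mulr0 mul0r.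
Qed.

Lemma matrix_units_prod (U V : finType) (e : U -> U -> A) (g : V -> V -> A) :
  matrix_units e -> matrix_units g ->
  (forall a b c d, e a b * g c d = g c d * e a b) ->
  matrix_units (fun x y : U * V => e x.1 y.1 * g x.2 y.2).
Proof.
move=> [eM e1] [gM g1] eg; split=> [[a a'] [b b'] [c c'] [d d'] /=|].
  rewrite mulrA -[e a b * _ * _]mulrA -eg mulrA -mulrA eM gM xpair_eqE.
  by case: eqP => _; case: eqP => _; rewrite ?mul0r ?mulr0.
rewrite -(pair_bigA _ (fun a b => e a a * g b b)) /= -e1.
by apply: eq_bigr => a _; rewrite -mulr_sumr g1 mulr1.
Qed.

Lemma unit_span_prod (U V : finType) (e : U -> U -> A) (g : V -> V -> A) x y :
  unit_span e x -> unit_span g y ->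
  unit_span (fun x y : U * V => e x.1 y.1 * g x.2 y.2) (x * y).
Proof.
move=> [M ->] [N ->].
rewrite mulr_suml; apply: unit_span_sum => a _.
rewrite mulr_suml; apply: unit_span_sum => b _.
rewrite mulr_sumr; apply: unit_span_sum => c _.
rewrite mulr_sumr; apply: unit_span_sum => d _.
rewrite -scalerAl -scalerAr; do 2 apply: unit_span_scale.
exact: (unit_span_unit _ (a, c) (b, d)).
Qed.

Lemma matrix_units_ord (U : finType) (e : U -> U -> A) n : #|U| = n.+1 ->
  matrix_units e -> exists g : 'I_n.+1 -> 'I_n.+1 -> A,
    matrix_units g /\ forall x, unit_span e x -> unit_span g x.
Proof.
move=> Un [eM e1].
pose h (i : 'I_n.+1) : U := enum_val (cast_ord (esym Un) i).
pose h' (u : U) := cast_ord Un (enum_rank u).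
have hK : cancel h h' by move=> i; rewrite /h /h' enum_valK cast_ordKV.
have h'K : cancel h' h by move=> u; rewrite /h /h' cast_ordK enum_rankK.
have bh : bijective h by exists h'.
exists (fun i j => e (h i) (h j)); split.
  split; first by move=> a b c d; rewrite eM (inj_eq (can_inj hK)).
  by rewrite -e1 (reindex h) //; exact: onW_bij.
move=> _ [M ->]; exists (fun i j => M (h i) (h j)).
rewrite (reindex h) /=; last exact: onW_bij.
by apply: eq_bigr => i _; rewrite (reindex h) //; exact: onW_bij.
Qed.

End matrix_units.

(** * Finite products of commuting systems *)

Section commuting_units.
Variables (F : fieldType) (A : algType F) (I : eqType) (U : I -> finType).
Variable e : forall i, U i -> U i -> A.
Hypothesis eU : forall i, matrix_units (@e i).
Hypothesis eC : forall i j a b c d, i != j -> @e i a b * @e j c d = @e j c d * @e i a b.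

(** The clause on predicates [P] is an induction principle expressing that the entries of [g] are
    products of entries of the given systems. The induction on [s] uses it to see that the next
    system commutes with [g]. *)
Lemma commuting_units_prod (s : seq I) : uniq s ->
  exists (V : finType) (g : V -> V -> A),
    [/\ matrix_units g, #|V| = (\prod_(i <- s) #|U i|)%N,
        (forall P : A -> Prop, P 1 -> (forall x y, P x -> P y -> P (x * y)) ->
           (forall i a b, i \in s -> P (@e i a b)) -> forall a b, P (g a b))
      & forall i a b, i \in s -> unit_span g (@e i a b)].
Proof.
elim: s => [_|i s IH /= /andP [nis us]].
  exists unit, (fun _ _ => 1); split => //; last by rewrite big_nil card_unit.
  split; first by move=> [] [] [] [] /=; rewrite mulr1.
  by rewrite (bigD1 tt) //= big1 ?addr0 // => - [].
have [V [g [gU cV gP gs]]] := IH us.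
have eg a b c d : @e i a b * g c d = g c d * @e i a b.
  apply: (gP (fun x => @e i a b * x = x * @e i a b)).
  - by rewrite mulr1 mul1r.
  - by move=> x y ex ey; rewrite mulrA ex -mulrA ey mulrA.
  - by move=> j c' d' js; apply: eC; apply: contraNneq nis => ->.
exists (U i * V)%type, (fun x y => @e i x.1 y.1 * g x.2 y.2); split.
- exact: matrix_units_prod.
- by rewrite card_prod cV big_cons.
- move=> P P1 PM Pe [a a'] [b b'] /=; apply: (PM); first exact/Pe/mem_head.
  by apply: gP => // j c d js; apply: Pe; rewrite inE js orbT.
- move=> j a b; rewrite inE => /predU1P [ji|js].
    move: a b; rewrite ji => a b; rewrite -[e _ _]mulr1; apply: unit_span_prod.
      exact: unit_span_unit.
    exact: unit_span1.
  rewrite -[e _ _]mul1r; apply: unit_span_prod; last exact: gs.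
  exact: unit_span1.
Qed.

End commuting_units.

(** * Ranks of idempotents and divisibility of matrix sizes *)

Lemma mxrank_add_idem (F : fieldType) n (P Q : 'M[F]_n) :
  P *m P = P -> Q *m Q = Q -> P *m Q = 0 -> Q *m P = 0 ->
  \rank (P + Q)%R = (\rank P + \rank Q)%N.
Proof.
move=> PP QQ PQ QP.
(* Right multiplication by [P] and by [Q] fixes the intersection of the row spaces, hence so does
   multiplication by [P *m Q], which is 0. *)
have cap0 : (P :&: Q)%MS = 0.
  have /submxP [Y YP] := capmxSl P Q; have /submxP [Z ZQ] := capmxSr P Q.
  have XP : (P :&: Q)%MS *m P = (P :&: Q)%MS by rewrite {1}YP -mulmxA PP -YP.
  have XQ : (P :&: Q)%MS *m Q = (P :&: Q)%MS by rewrite {1}ZQ -mulmxA QQ -ZQ.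
  by rewrite -XQ -XP -mulmxA PQ mulmx0.
rewrite -(mxrank_disjoint_sum cap0); apply/eqmx_rank/andP; split.
  exact: addmx_sub_adds.
rewrite addsmx_sub; apply/andP; split.
  have {1}-> : P = P *m (P + Q) by rewrite mulmxDr PP PQ addr0.
  exact: submxMl.
have {1}-> : Q = Q *m (P + Q) by rewrite mulmxDr QQ QP add0r.
exact: submxMl.
Qed.

(* Over a field of positive characteristic traces lose information, hence ranks. *)
Lemma matrix_units_dvdn (F : fieldType) (N : nat) (U : finType)
  (e : U -> U -> 'M[F]_N.+1) : matrix_units e -> (#|U| %| N.+1)%N.
Proof.
move=> [eM e1].
have rank_sum (s : seq U) : uniq s ->
    \rank (\sum_(a <- s) e a a)%R = (\sum_(a <- s) \rank (e a a))%N.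
  elim: s => [|a s IH /= /andP [nas us]]; first by rewrite !big_nil mxrank0.
  rewrite !big_cons mxrank_add_idem ?IH //.
  - by rewrite -[_ *m _]/(_ * _) eM eqxx.
  - rewrite -[_ *m _]/(_ * _) mulr_suml; apply: eq_big_seq => b bs.
    rewrite mulr_sumr (bigD1_seq b) //= eM eqxx big1 ?addr0 // => c /negbTE nc.
    by rewrite eM eq_sym nc.
  - rewrite -[_ *m _]/(_ * _) mulr_sumr big_seq big1 // => b bs.
    by rewrite eM; case: eqP => // ab; rewrite ab bs in nas.
  - rewrite -[_ *m _]/(_ * _) mulr_suml big_seq big1 // => b bs.
    by rewrite eM; case: eqP => // ba; rewrite -ba bs in nas.
(* Each diagonal unit factors through any other, so all have the same rank, and [N.+1] is [#|U|]
   times this rank. *)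
have rank_le a b : (\rank (e a a) <= \rank (e b b))%N.
  have -> : e a a = e a b *m (e b b *m e b a).
    by rewrite -![_ *m _]/(_ * _) eM eqxx eM eqxx.
  exact: leq_trans (mxrankM_maxr _ _) (mxrankM_maxl _ _).
have := rank_sum _ (index_enum_uniq U); rewrite e1 mxrank1 => ->.
have [a _|U0] := pickP U; last by rewrite big1 ?dvdn0 // => a; have := U0 a.
rewrite (eq_bigr (fun=> \rank (e a a))) => [|b _].
  by rewrite sum_nat_const dvdn_mulr.
by apply/eqP; rewrite eqn_leq !rank_le.
Qed.

Lemma matrix_units_delta (F : fieldType) (A : algType F) n (f : 'M[F]_n.+1 -> A) :
  unital_alg_embedding f -> matrix_units (fun i j => f (delta_mx i j)).
Proof.
move=> [fL fM f1 _].
have f0 : f 0 = 0 by have := fL (-1) 0 0; rewrite scaler0 addr0 scaleN1r addNr.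
split=> [a b c d|].
  by rewrite -fM -[_ * _]/(_ *m _) mul_delta_mx_cond; case: eqP => _ //; rewrite mulr0n.
rewrite -f1 -[1]/1%:M mx1_sum_delta; apply: esym; apply: (big_morph f) => // x y.
by rewrite -[x]scale1r fL !scale1r.
Qed.

Lemma matrix_units_card_gt0 (F : fieldType) (A : algType F) (U : finType)
  (e : U -> U -> A) : matrix_units e -> (0 < #|U|)%N.
Proof.
move=> [_ e1]; rewrite lt0n; apply/eqP => /card0_eq U0; move/eqP: e1.
by rewrite big1 ?[_ == 1]eq_sym ?oner_eq0 // => a; have := U0 a.
Qed.

(** * Algebras generated by commuting systems of matrix units *)

Section generated.
Variables (F : fieldType) (A : algType F) (I : eqType) (U : I -> finType).
Variable e : forall i, U i -> U i -> A.

Definition letter : Type := {i : I & (U i * U i)%type}.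

Definition word (w : seq letter) : A :=
  \prod_(l <- w) @e (tag l) (tagged l).1 (tagged l).2.

Hypothesis eU : forall i, matrix_units (@e i).
Hypothesis eC : forall i j a b c d, i != j -> @e i a b * @e j c d = @e j c d * @e i a b.
Hypothesis gen : forall x, lin_span (range word) x.

(** An element is a finite combination of words, in which finitely many indices occur. Quantifying
    over every [g] whose span contains the letters at these indices lets the support be found before
    the product system is built. *)
Lemma generated_support (xs : seq A) : exists2 s : seq I, uniq s &
  forall (V : finType) (g : V -> V -> A), matrix_units g ->
    (forall i a b, i \in s -> unit_span g (@e i a b)) ->
    forall x, x \in xs -> unit_span g x.
Proof.
suff [s sP] : exists s : seq I,
    forall (V : finType) (g : V -> V -> A), matrix_units g ->
    (forall i a b, i \in s -> unit_span g (@e i a b)) ->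
    forall x, x \in xs -> unit_span g x.
  exists (undup s); first exact: undup_uniq.
  by move=> V g gU gs; apply: sP => // i a b; rewrite -mem_undup; exact: gs.
elim: xs => [|x xs [s sP]]; first by exists [::].
have [t tP] : exists t : seq I,
    forall (V : finType) (g : V -> V -> A), matrix_units g ->
    (forall i a b, i \in t -> unit_span g (@e i a b)) -> unit_span g x.
  have [l [lS ->]] := gen x; elim: l lS => [|p l IH] lS.
    by exists [::] => V g _ _; rewrite big_nil; exact: unit_span0.
  have [|t tP] := IH; first by move=> q ql; apply: lS; rewrite inE ql orbT.
  have [w _ wp] := lS p (mem_head _ _).
  exists (map tag w ++ t) => V g gU gs; rewrite big_cons; apply: unit_span_add.
    apply: unit_span_scale; rewrite -wp /word.
    have {}gs i a b : i \in map tag w -> unit_span g (@e i a b).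
      by move=> iw; apply: gs; rewrite mem_cat iw.
    elim: w {wp} gs => [|q w IHw] gs; first by rewrite big_nil; exact: unit_span1.
    rewrite big_cons; apply: unit_span_mul => //; first exact/gs/mem_head.
    by apply: IHw => i a b iw; apply: gs; rewrite inE iw orbT.
  by apply: tP => // i a b it; apply: gs; rewrite mem_cat it orbT.
exists (t ++ s) => V g gU gs y; rewrite inE => /predU1P [->|].
  by apply: tP => // i a b it; apply: gs; rewrite mem_cat it.
by apply: sP => // i a b js; apply: gs; rewrite mem_cat js orbT.
Qed.

Lemma generated_embedding (xs : seq A) : exists2 s : seq I, uniq s &
  exists (n : nat) (f : 'M[F]_n.+1 -> A),
    [/\ n.+1 = (\prod_(i <- s) #|U i|)%N, unital_alg_embedding f
      & forall x, x \in xs -> exists y, f y = x].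
Proof.
have [s us sP] := generated_support xs; exists s => //.
have [V [g [gU cV _ gs]]] := commuting_units_prod eU eC us.
have cV1 : #|V| = #|V|.-1.+1 by rewrite prednK // (matrix_units_card_gt0 gU).
have [h [hU gh]] := matrix_units_ord cV1 gU.
exists #|V|.-1, (fun M : 'M[F]_#|V|.-1.+1 => \sum_i \sum_j M i j *: h i j).
split; [by rewrite -cV1|exact: matrix_units_embedding|].
move=> x /(sP _ _ gU gs) /gh [M ->]; exists (\matrix_(i, j) M i j).
by apply: eq_bigr => i _; apply: eq_bigr => j _; rewrite mxE.
Qed.

Lemma generated_locally_matrix : locally_matrix A.
Proof.
move=> xs; have [s _ [n [f [_ fE fP]]]] := generated_embedding xs.
by exists n, f.
Qed.

Lemma Dset_prod (s : seq I) : uniq s -> Dset A (\prod_(i <- s) #|U i|)%N.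
Proof.
move=> us; have [V [g [gU <- _ _]]] := commuting_units_prod eU eC us.
have V0 := matrix_units_card_gt0 gU; split => //.
have [h [hU _]] := matrix_units_ord (esym (prednK V0)) gU.
by eexists; exact: matrix_units_embedding hU.
Qed.

(** The images of the standard matrix units all lie in the image of one larger matrix algebra.
    Injectivity pulls them back to matrix units there, and [matrix_units_dvdn] applies. *)
Lemma Dset_dvd_prod n : Dset A n ->
  exists2 s : seq I, uniq s & (n %| \prod_(i <- s) #|U i|)%N.
Proof.
move=> [n0 [f fE]].
pose d (i j : 'I_n.-1.+1) := f (delta_mx i j).
have [eM e1] : matrix_units d := matrix_units_delta fE.
have [s us [m [g [mE [gL gM g1 gI] gP]]]] :=
  generated_embedding [seq d p.1 p.2 | p : 'I_n.-1.+1 * 'I_n.-1.+1].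
exists s => //.
have /choice [y yP] (p : 'I_n.-1.+1 * 'I_n.-1.+1) : exists y, g y = d p.1 p.2.
  by apply: gP; apply/mapP; exists p => //; rewrite mem_enum.
have g0 : g 0 = 0 by have := gL (-1) 0 0; rewrite scaler0 addr0 scaleN1r addNr.
have : matrix_units (fun i j => y (i, j)).
  split=> [a b c c'|]; apply: gI.
    by rewrite gM !yP eM; case: eqP => _; rewrite ?yP ?g0.
  rewrite g1 -e1 (big_morph g (id1 := 0) (op1 := +%R)) //.
    by apply: eq_bigr => a _; rewrite yP.
  by move=> u v; rewrite -[u]scale1r gL !scale1r.
by move/matrix_units_dvdn; rewrite card_ord prednK // mE.
Qed.

End generated.

(** * The endomorphism algebra of a function space *)

Section endomorphisms.
Variables (F : fieldType) (X : Type) (x0 : X).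

(* The point [x0] is a parameter because it makes the algebra nontrivial. *)
Record endo (x : X) := Endo {
  endo_fun :> (X -> F) -> X -> F;
  endo_linear : forall a f g y,
    endo_fun (fun x => a * f x + g x) y = a * endo_fun f y + endo_fun g y }.

Local Notation E := (endo x0).

Lemma endoP (u v : E) : (forall f y, u f y = v f y) -> u = v.
Proof.
case: u v => [u ul] [v vl] /= uv; have e : u = v by apply/funext => f; apply/funext.
by case: v / e in vl uv *; congr Endo; exact: Prop_irrelevance.
Qed.

HB.instance Definition _ := gen_eqMixin E.
HB.instance Definition _ := gen_choiceMixin E.

Program Definition endo_zero : E := @Endo x0 (fun _ _ => 0) _.
Next Obligation. by rewrite mulr0 addr0. Qed.

Program Definition endo_opp (u : E) : E := @Endo x0 (fun f y => - u f y) _.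
Next Obligation. by rewrite endo_linear opprD mulrN. Qed.

Program Definition endo_add (u v : E) : E := @Endo x0 (fun f y => u f y + v f y) _.
Next Obligation. by rewrite !endo_linear mulrDr addrACA. Qed.

Program Definition endo_scale (k : F) (u : E) : E := @Endo x0 (fun f y => k * u f y) _.
Next Obligation. by rewrite endo_linear mulrDr mulrCA. Qed.

Program Definition endo_one : E := @Endo x0 (fun f y => f y) _.

Program Definition endo_mul (u v : E) : E := @Endo x0 (fun f y => u (v f) y) _.
Next Obligation.
rewrite -endo_linear; congr (u _ y).
by apply/funext => z; exact: endo_linear.
Qed.

Fact endo_addA : associative endo_add.
Proof. by move=> u v w; apply: endoP => f y /=; rewrite addrA. Qed.
Fact endo_addC : commutative endo_add.
Proof. by move=> u v; apply: endoP => f y /=; rewrite addrC. Qed.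
Fact endo_add0 : left_id endo_zero endo_add.
Proof. by move=> u; apply: endoP => f y /=; rewrite add0r. Qed.
Fact endo_addN : left_inverse endo_zero endo_opp endo_add.
Proof. by move=> u; apply: endoP => f y /=; rewrite addNr. Qed.

HB.instance Definition _ :=
  GRing.isZmodule.Build E endo_addA endo_addC endo_add0 endo_addN.

Fact endo_mulA : associative endo_mul.
Proof. by move=> u v w; apply: endoP. Qed.
Fact endo_mul1l : left_id endo_one endo_mul.
Proof. by move=> u; apply: endoP. Qed.
Fact endo_mul1r : right_id endo_one endo_mul.
Proof. by move=> u; apply: endoP. Qed.
Fact endo_mulDl : left_distributive endo_mul +%R.
Proof. by move=> u v w; apply: endoP. Qed.
Fact endo_mulDr : right_distributive endo_mul +%R.
Proof.
move=> u v w; apply: endoP => f y /=.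
rewrite -[u (v f) y]mul1r -endo_linear; congr (u _ y).
by apply/funext => z; rewrite mul1r.
Qed.
Fact endo_one_neq0 : endo_one != 0.
Proof.
apply/eqP => /(congr1 (fun u : E => u (fun=> 1) x0)) /= /eqP.
by rewrite oner_eq0.
Qed.

HB.instance Definition _ := GRing.Zmodule_isNzRing.Build E
  endo_mulA endo_mul1l endo_mul1r endo_mulDl endo_mulDr endo_one_neq0.

Fact endo_scaleA (a b : F) (u : E) : endo_scale a (endo_scale b u) = endo_scale (a * b) u.
Proof. by apply: endoP => f y /=; rewrite mulrA. Qed.
Fact endo_scale1 : left_id 1 endo_scale.
Proof. by move=> u; apply: endoP => f y /=; rewrite mul1r. Qed.
Fact endo_scaleDr : right_distributive endo_scale +%R.
Proof. by move=> a u v; apply: endoP => f y /=; rewrite mulrDr. Qed.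
Fact endo_scaleDl (u : E) : {morph endo_scale^~ u : a b / a + b}.
Proof. by move=> a b; apply: endoP => f y /=; rewrite mulrDl. Qed.

HB.instance Definition _ := GRing.Zmodule_isLmodule.Build F E
  endo_scaleA endo_scale1 endo_scaleDr endo_scaleDl.

Fact endo_scaleAl (a : F) (u v : E) : a *: (u * v) = (a *: u) * v.
Proof. by apply: endoP. Qed.

HB.instance Definition _ := GRing.Lmodule_isLalgebra.Build F E endo_scaleAl.

Fact endo_scaleAr (a : F) (u v : E) : a *: (u * v) = u * (a *: v).
Proof.
apply: endoP => f y; rewrite -[LHS]addr0.
(* The linearity axiom carries an additive term, so homogeneity first needs [u] to kill the zero
   function; the scalar -1 shows this. *)
have -> : 0 = u (fun=> 0) y.
  have := endo_linear u (-1) (fun=> 0) (fun=> 0) y.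
  by rewrite [in RHS]mulN1r addNr => e; rewrite -[LHS]e; congr (u _ y); apply/funext => z; rewrite mulr0 addr0.
by rewrite -[_ + _]/(a * u (v f) y + _) -endo_linear; congr (u _ y);
  apply/funext => z; rewrite addr0.
Qed.

HB.instance Definition _ := GRing.Lalgebra_isAlgebra.Build F E endo_scaleAr.

Lemma endo_sumE (K : Type) (r : seq K) (u : K -> E) f y :
  (\sum_(k <- r) u k) f y = \sum_(k <- r) u k f y.
Proof. by elim: r => [|k r IH]; rewrite ?big_nil // !big_cons -IH. Qed.

Lemma endo_scaleE (a : F) (u : E) f y : (a *: u) f y = a * u f y.
Proof. by []. Qed.

End endomorphisms.

(** * Matrix units acting on a single coordinate *)

Section local_units.
Variables (F : fieldType) (I : eqType) (n : I -> nat).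
Let X := forall i, 'I_(n i).+1.

Definition point0 : X := fun=> ord0.

Local Notation E := (endo F point0).

(** The matrix unit $E_{ab}$ in the coordinate [i], the identity in all the others. *)
Program Definition local_unit i (a b : 'I_(n i).+1) : E :=
  @Endo F X point0 (fun f x => if x i == a then f (dfwith x b) else 0) _.
Next Obligation. by case: ifP => _; rewrite ?mulr0 ?addr0. Qed.

Lemma dfwith_same i (x : X) (a b : 'I_(n i).+1) : dfwith (dfwith x a) b = dfwith x b.
Proof.
apply: functional_extensionality_dep => j.
by case: (dfwithP x b) => [|j' ij]; rewrite ?dfwith_in // !dfwith_out.
Qed.

Lemma dfwith_id i (x : X) : dfwith x (x i) = x.
Proof.
by apply: functional_extensionality_dep => j; case: (dfwithP x (x i)).
Qed.

Lemma dfwithC i j (x : X) (a : 'I_(n i).+1) (b : 'I_(n j).+1) : i != j ->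
  dfwith (dfwith x a) b = dfwith (dfwith x b) a.
Proof.
move=> ij; apply: functional_extensionality_dep => k.
have [e|jk] := eqVneq j k.
  by case: k / e; rewrite dfwith_in dfwith_out // dfwith_in.
rewrite dfwith_out //; have [e|ik] := eqVneq i k.
  by case: k / e jk => jk; rewrite !dfwith_in.
by rewrite !dfwith_out.
Qed.

Lemma local_units i : matrix_units (@local_unit i).
Proof.
split=> [a b c d|].
  apply: endoP => f x /=; rewrite dfwith_in dfwith_same.
  by case: (b == c) => //=; case: ifP.
apply: endoP => f x; rewrite endo_sumE (bigD1 (x i)) //= eqxx dfwith_id.
by rewrite big1 ?addr0 // => a; rewrite eq_sym => /negbTE ->.
Qed.

Lemma local_unitC i j a b c d : i != j ->
  @local_unit i a b * @local_unit j c d = @local_unit j c d * @local_unit i a b.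
Proof.
move=> ij; apply: endoP => f x /=.
have ji : j != i by rewrite eq_sym.
rewrite !dfwith_out // (dfwithC x b d ij).
by case: ifP => _; case: ifP.
Qed.

(* The operators are separated by points whose only vanishing coordinate is the one at [h t]. *)
Lemma local_unit_free (T : Type) (h : T -> I) : injective h ->
  (forall t, (0 < n (h t))%N) ->
  injective (fun t => @local_unit (h t) ord0 ord0) /\
  lin_free (range (fun t => @local_unit (h t) ord0 ord0)).
Proof.
move=> hI n0.
pose y t : X := fun i => if i == h t then ord0 else ord_max.
(* When [h t'] differs from [h t], the point [y t] has [ord_max] at [h t'], which is nonzero because
   [n (h t')] is positive. *)
have sep t t' : (@local_unit (h t') ord0 ord0) (fun=> 1) (y t) = (h t' == h t)%:R.
  rewrite /= /y; case: (h t' == h t); first by rewrite eqxx.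
  by rewrite -val_eqE /= eqn0Ngt n0.
split=> [t t' e|].
  apply: hI; apply/eqP; have := sep t' t; rewrite e sep eqxx.
  by case: eqP => // _ /eqP; rewrite oner_eq0.
move=> s c us sR s0 x xs; have [t _ tx] := sR x xs.
have := congr1 (fun u : E => u (fun=> 1) (y t)) s0.
rewrite /= endo_sumE (bigD1_seq x) // endo_scaleE -tx sep eqxx mulr1 big_seq_cond big1 => [|z /andP [zs zx]].
  by rewrite /= addr0 => ->.
have [t' _ tz] := sR z zs.
rewrite endo_scaleE -tz sep.
case: eqP => [/hI e|]; last by rewrite mulr0.
by rewrite -tz e eqxx in zx.
Qed.

End local_units.

(** * The subalgebra spanned by words *)

Section generated_subalgebra.
Variables (F : fieldType) (R : algType F) (I : eqType) (U : I -> finType).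

Lemma word_cat (e : forall i, U i -> U i -> R) w w' :
  word e (w ++ w') = word e w * word e w'.
Proof. by rewrite /word big_cat. Qed.

Variable e : forall i, U i -> U i -> R.

Definition in_generated : pred R := fun x => `[< lin_span (range (word e)) x >].

Lemma in_generatedP x : reflect (lin_span (range (word e)) x) (x \in in_generated).
Proof. exact: asboolP. Qed.

(** Concatenation multiplies words, so their linear span is already closed under products. *)
Lemma generated_closed : GRing.subalg_closed in_generated.
Proof.
split.
- by apply/in_generatedP/lin_span_incl; exists [::] => //; rewrite /word big_nil.
- move=> a x y /in_generatedP Sx /in_generatedP Sy.
  by apply/in_generatedP/lin_span_add => //; exact: lin_span_scale.
- move=> x y /in_generatedP [l [lS ->]] /in_generatedP [m [mS ->]].
  apply/in_generatedP; rewrite mulr_suml; apply: lin_span_sum => p /lS [w _ wp].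
  rewrite mulr_sumr; apply: lin_span_sum => p' /mS [w' _ wp'].
  rewrite -scalerAl -scalerAr; do 2 apply: lin_span_scale.
  by apply: lin_span_incl; exists (w ++ w') => //; rewrite word_cat wp wp'.
Qed.

Inductive generated := Generated (u : R) & u \in in_generated.
Definition generated_val x := let: Generated u _ := x in u.

HB.instance Definition _ := [isSub for generated_val].
HB.instance Definition _ := [Choice of generated by <:].
HB.instance Definition _ := GRing.SubChoice_isSubAlgebra.Build F R in_generated generated
  (GRing.subalg_closed_semi generated_closed).

Fact in_generated_unit i a b : @e i a b \in in_generated.
Proof.
apply/in_generatedP/lin_span_incl; exists [:: Tagged (fun i => (U i * U i)%type) (a, b)] => //.
by rewrite /word big_seq1.
Qed.

Definition generated_unit i a b : generated := Generated (@in_generated_unit i a b).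

Lemma val_word w : val (word generated_unit w) = word e w.
Proof. by rewrite /word rmorph_prod. Qed.

Lemma generated_units i : matrix_units (@e i) -> matrix_units (@generated_unit i).
Proof.
move=> [eM e1]; split=> [a b c d|]; apply: val_inj.
  by rewrite rmorphM /= eM; case: eqP.
by rewrite rmorph_sum rmorph1 -e1.
Qed.

(** Membership only provides a combination of words in the ambient algebra [R]; lifting it word by
    word gives the spanning hypothesis inside the subalgebra. *)
Lemma generated_span (x : generated) : lin_span (range (word generated_unit)) x.
Proof.
have /in_generatedP [l [lS xE]] := valP x.
have /choice [w wP] (p : F * R) : exists w, p \in l -> word e w = p.2.
  have [/lS [w _ <-]|_] := boolP (p \in l); first by exists w.
  by exists [::].
exists [seq (p.1, word generated_unit (w p)) | p <- l]; split.
  by move=> _ /mapP [p pl ->] /=; exists (w p).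
apply: val_inj; rewrite xE big_map rmorph_sum; apply: eq_big_seq => p pl.
by rewrite -(wP _ pl) -val_word.
Qed.

End generated_subalgebra.

Lemma lin_free_morph (F : fieldType) (A B : algType F) (f : {linear A -> B}) (T : Type)
  (L : T -> A) : injective f -> lin_free (range (f \o L)) -> lin_free (range L).
Proof.
move=> fI fL s c us sL s0 x xs.
(* Coefficients are functions of the vectors, so they are carried to [B] along a left inverse of
   [f]. *)
have [g gK] : exists g, cancel f g.
  have /choice [g gP] (y : B) : exists x, forall x', f x' = y -> x' = x.
    have [[x' <-]|ny] := pselect (exists x', f x' = y).
      by exists x' => x'' /fI.
    by exists 0 => x' e; case: ny; exists x'.
  by exists g => x'; apply: esym; exact: gP.
have := fL (map f s) (c \o g) _ _ _ (f x) (map_f f xs).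
rewrite /= gK; apply; first by rewrite map_inj_uniq.
  by move=> _ /mapP [z /sL [t _ <-] ->]; exists t.
rewrite big_map -[RHS](linear0 f) -s0 linear_sum.
by apply: eq_bigr => z _; rewrite /= gK linearZ.
Qed.

Lemma logn_bigprod (I : Type) (s : seq I) (f : I -> nat) p : (forall i, 0 < f i)%N ->
  logn p (\prod_(i <- s) f i)%N = (\sum_(i <- s) logn p (f i))%N.
Proof.
move=> f0; elim: s => [|i s IH]; first by rewrite !big_nil logn1.
by rewrite !big_cons lognM ?IH // prodn_gt0.
Qed.

(** Serves to bound the number of factors that contribute to a prime of finite exponent. *)
Lemma sum_mem_leq (I : eqType) (s r : seq I) : uniq s ->
  (\sum_(i <- s) (i \in r) <= size r)%N.
Proof.
move=> us; rewrite -big_mkcond /= sum1_count -size_filter.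
apply: uniq_leq_size; first exact: filter_uniq.
by move=> i; rewrite mem_filter => /andP [].
Qed.

(** * The algebra with prescribed dimension and Steinitz number *)

Section construction.
Variables (F : fieldType) (tau : steinitz) (q : nat) (T : Type).
Hypotheses (q_prime : prime q) (tauq : tau q = None).

(** The alias [{classic T}] supplies the decidable equality required of an index type. *)
Definition factor_index : eqType := ({classic T} + nat * nat)%type.

(* A factor of size [q] for each element of [T] gives the dimension; the factors
   [inr (p, j)] with [j < k_p] give the Steinitz number. *)
Definition factor_size (i : factor_index) : nat :=
  match i with
  | inl _ => q
  | inr (p, j) => if prime p && (if tau p is Some k then j < k else true)%N then p else 1
  end.

Lemma factor_size_gt0 i : (0 < factor_size i)%N.
Proof.
case: i => [_|[p j]] /=; first exact: prime_gt0.
by case: ifP => // /andP [/prime_gt0].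
Qed.

Let n i := (factor_size i).-1.
Let sizeE i : #|'I_(n i).+1| = factor_size i.
Proof. by rewrite card_ord prednK // factor_size_gt0. Qed.

(** For finite $k_p$, only the indices [inr (p, j)] with $j < k_p$ contribute to the exponent of
    $p$, each contributing 1. The factors of size $q$ do not interfere: $k_q$ is infinite, so $p
    \neq q$. *)
Lemma factor_prod_dvd s : uniq s ->
  steinitz_dvd (steinitz_of_nat (\prod_(i <- s) factor_size i)) tau.
Proof.
move=> us p pp; rewrite /steinitz_of_nat /enat_le.
case tp : (tau p) => [k|//].
rewrite logn_bigprod; last exact: factor_size_gt0.
have := @sum_mem_leq factor_index s [seq inr (p, j) | j <- iota 0 k] us.
rewrite size_map size_iota; apply: leq_trans; apply: leq_sum => i _.
case: i => [t|[p' j]] /=.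
  rewrite logn_prime //; case: eqP => // pq; by rewrite pq tauq in tp.
case: ifP => [/andP [pp' jk]|]; last by rewrite logn1.
rewrite logn_prime //; have [e|//] := eqVneq p p'.
rewrite -e tp in jk *; rewrite lt0b; apply/mapP; exists j => //.
by rewrite mem_iota.
Qed.

(** Realises every finite exponent allowed at [p], which bounds all common multiples from below. *)
Lemma factor_prod_pow p j : prime p -> enat_le (Some j) (tau p) ->
  (\prod_(i <- [seq inr (p, l) | l <- iota 0 j] : seq factor_index) factor_size i = p ^ j)%N.
Proof.
move=> pp jk; rewrite big_map (eq_big_seq (fun=> p)) => [|l].
  by rewrite big_const_seq count_predT size_iota iter_muln_1.
rewrite mem_iota /= add0n pp /= => lj.
by case: (tau p) jk => //= k jk; rewrite (leq_trans lj jk).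
Qed.

Lemma embeds_letters : infinite_type T ->
  embeds (seq (letter (fun i : factor_index => 'I_(n i).+1))) T.
Proof.
move=> /infinite_type_nat NT; have TT := embeds_square NT.
have BT : embeds (T * nat) T.
  by apply: embeds_trans TT; apply: embeds_prod => //; exists id.
have IT : embeds factor_index T.
  apply: embeds_trans BT; have [c cI] := NT.
  (* The second component distinguishes the two summands. *)
  exists (fun i => match i with inl t => (t, 0%N) | inr x => (c (pickle x), 1%N) end).
  by move=> [t|x] [t'|x'] [] // => [->|/cI/(pcan_inj pickleK) ->].
have LT : embeds (letter (fun i : factor_index => 'I_(n i).+1)) T.
  apply: embeds_trans BT; have [g gI] := IT.
  (* The position of a matrix unit is coded by a natural number, uniformly in the index. *)
  exists (fun l => (g (tag l), pickle (val (tagged l).1, val (tagged l).2))).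
  move=> [i [a b]] [i' [a' b']] /= [/gI ii]; case: i' / ii a' b' => a' b'.
  by move/(pcan_inj pickleK) => [/val_inj -> /val_inj ->].
have [g gI] := LT; apply: embeds_trans (embeds_seq NT).
by exists (map g); exact: inj_map.
Qed.

Let R := endo F (@point0 factor_index n).
Let A := generated (fun i => @local_unit F factor_index n i).
Let e i (a b : 'I_(n i).+1) : A := generated_unit (fun i => @local_unit F factor_index n i) a b.

Let eU i : matrix_units (@e i).
Proof. exact/generated_units/local_units. Qed.

Let eC i j a b c d : i != j -> @e i a b * @e j c d = @e j c d * @e i a b.
Proof. by move=> ij; apply: val_inj; rewrite !rmorphM; exact: local_unitC. Qed.

Let e_span (x : A) : lin_span (range (word e)) x.
Proof. exact: generated_span. Qed.

Lemma construction_spec : infinite_type T ->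
  exists A : algType F, [/\ locally_matrix A, dim_eq_card A T & steinitz_n_eq A tau].
Proof.
move=> hT; exists A; split.
- exact: (generated_locally_matrix eU eC e_span).
(* Since $q > 1$, the coordinates indexed by [T] take at least two values, as separating the
   idempotents requires. *)
- have q1 t : (0 < n (inl t))%N by rewrite /n /= -ltnS prednK ?prime_gt1 ?prime_gt0.
  have inlI : injective (inl : T -> factor_index) by move=> t t' [].
  have [LI Lfree] := @local_unit_free F factor_index n T inl inlI q1.
  apply: (@dim_eq_card_between F A T _ (fun t => @e (inl t) ord0 ord0) (word e)) => //.
  + by move=> t t' /(congr1 val); exact: LI.
  + exact: (@lin_free_morph F A R val _ _ val_inj).
  + move=> _ [t _ <-].
    exists [:: Tagged (fun i => ('I_(n i).+1 * 'I_(n i).+1)%type) (ord0 : 'I_(n (inl t)).+1, ord0)] => //.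
    by rewrite /word big_seq1.
  + exact: embeds_letters.
- split=> [m /(Dset_dvd_prod eU eC e_span) [s us]|sigma sigmaP p pp].
    under eq_bigr do rewrite sizeE.
    move=> ms p pp; have := factor_prod_dvd us pp; rewrite /steinitz_of_nat /enat_le.
    case: (tau p) => // k; apply: leq_trans; apply: dvdn_leq_log ms.
    by apply: prodn_gt0 => i; exact: factor_size_gt0.
  (* The first [j] factors attached to [p] give a unital matrix subalgebra of size $p^j$. *)
  have pow j : enat_le (Some j) (tau p) -> enat_le (Some j) (sigma p).
    move=> jk; have := factor_prod_pow pp jk.
    set s := (map _ _) => sE; have us : uniq s.
      by rewrite map_inj_uniq ?iota_uniq // => x y [].
    have := Dset_prod eU eC us; under eq_bigr do rewrite sizeE.
    rewrite sE => /sigmaP /(_ p pp); rewrite /steinitz_of_nat lognX logn_prime // eqxx muln1.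
    by [].
  case tp : (tau p) pow => [k|] pow; first exact: (pow k (leqnn k)).
  (* If $k_p$ is infinite and [sigma p] were a finite $k$, the size $p^{k+1}$ would give a
     contradiction. *)
  by case sp : (sigma p) pow => [k|//] /(_ k.+1 I); rewrite /= ltnn.
Qed.

End construction.

Theorem theorem8 (F : closedFieldType) (tau : steinitz)
  (hq : exists q, prime q /\ tau q = None)
  (T : Type) (hT : infinite_type T) :
  exists A : algType F,
    [/\ locally_matrix A, dim_eq_card A T & steinitz_n_eq A tau].
Proof. by case: hq => q [q_prime tauq]; exact: construction_spec q_prime tauq hT. Qed.
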